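(* For any two integers $a,b\ge 3$ there exist a graph $G$ and an induced subgraph $H$ of $G$ such that $\gamma^{p}_{I}(G)=a$ and $\gamma^{p}_{I}(H)=b$.
   Context: All graphs are finite and simple. A perfect Italian dominating function (PID-function) of a graph $G$ is a function $f:V(G)\to\{0,1,2\}$ such that for every vertex $v$ with $f(v)=0$ we have $\sum_{u\in N(v)}f(u)=2$, where $N(v)$ is the open neighborhood of $v$. Its weight is $\sum_{u\in V(G)}f(u)$. The perfect Italian domination number $\gamma^{p}_{I}(G)$ is the minimum weight of a PID-function of $G$. *)

(* Defs.v *)
From HB Require Import structures.
From mathcomp Require Import all_boot.

Set Implicit Arguments.
Unset Strict Implicit.
Unset Printing Implicit Defensive.

Record sgraph := SGraph {
  vertex :> finType;
  adj : rel vertex;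
  adj_sym : symmetric adj;
  adj_irrefl : irreflexive adj
}.

Section InducedSubgraph.
Variables (G : sgraph) (S : {set G}).

Definition induced_adj : rel {x : G | x \in S} :=
  fun x y => adj (val x) (val y).

Lemma induced_adj_sym : symmetric induced_adj.
Proof. by move=> x y; apply: adj_sym. Qed.

Lemma induced_adj_irrefl : irreflexive induced_adj.
Proof. by move=> x; apply: adj_irrefl. Qed.

Definition induced : sgraph := SGraph induced_adj_sym induced_adj_irrefl.

End InducedSubgraph.

Section PerfectItalianDomination.
Variable G : sgraph.

Definition pid_function (f : {ffun G -> 'I_3}) : bool :=
  [forall v : G, (f v == 0 :> nat) ==> (\sum_(u : G | adj v u) f u == 2)].

Definition weight (f : {ffun G -> 'I_3}) : nat := \sum_(u : G) f u.

(* The constant function 1 is a PID-function, which makes the minimum below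
   well defined. *)
Definition all_one : {ffun G -> 'I_3} := [ffun=> inord 1].

Lemma all_one_pid : pid_function all_one.
Proof. by apply/forallP => v; rewrite ffunE inordK. Qed.

Definition pid_number : nat :=
  weight [arg min_(f < all_one | pid_function f) weight f].

Lemma pid_number_attained : exists2 f, pid_function f & weight f = pid_number.
Proof.
rewrite /pid_number; case: arg_minnP => [|f Pf _]; first exact: all_one_pid.
by exists f.
Qed.

Lemma pid_number_le f : pid_function f -> pid_number <= weight f.
Proof.
rewrite /pid_number; case: arg_minnP => [|g _ gmin]; first exact: all_one_pid.
exact: gmin.
Qed.

End PerfectItalianDomination.

(* Main.v *)
Require Import Defs.
From mathcomp Require Import all_boot.

Set Implicit Arguments.
Unset Strict Implicit.
Unset Printing Implicit Defensive.

(** Let [G] be the disjoint union of a star with [b] leaves and [a - 2] isolated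
    vertices.  Giving 2 to the center and 0 to the leaves is optimal on the star
    as soon as [b >= 2], and every isolated vertex needs weight at least 1.  The
    leaves alone induce an edgeless graph on [b] vertices. *)

Lemma pid_function_zero (G : sgraph) (f : {ffun G -> 'I_3}) (v : G) :
  pid_function f -> f v = 0 :> nat -> \sum_(u : G | adj v u) f u = 2.
Proof. by move=> /forallP/(_ v)/implyP pidf /eqP/pidf/eqP. Qed.

(** An empty neighborhood sums to 0, never to the 2 that the value 0 would require. *)
Lemma pid_function_isolated (G : sgraph) (f : {ffun G -> 'I_3}) (v : G) :
  pid_function f -> (forall u, adj v u = false) -> 0 < f v.
Proof.
move=> pidf isov; rewrite lt0n; apply/eqP => /(pid_function_zero pidf).
by rewrite big_pred0.
Qed.

(** The constant 1 gives the upper bound; for the lower bound, every vertex is isolated and hence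
    has positive value. *)
Lemma pid_number_edgeless (G : sgraph) :
  (forall u v : G, adj u v = false) -> pid_number G = #|G|.
Proof.
move=> edgeless; apply/eqP; rewrite eqn_leq -sum1_card; apply/andP; split.
  apply: leq_trans (pid_number_le (all_one_pid G)) _.
  by apply: leq_sum => v _; rewrite ffunE inordK.
have [f pidf <-] := pid_number_attained G.
by apply: leq_sum => v _; apply: pid_function_isolated.
Qed.

Section StarPlusIsolated.
Variables b c : nat.

Definition star_vertex : finType := (unit + ('I_b + 'I_c))%type.

Definition star_adj : rel star_vertex := fun x y =>
  match x, y with
  | inl _, inr (inl _) | inr (inl _), inl _ => true
  | _, _ => false
  end.

Lemma star_adj_sym : symmetric star_adj.
Proof. by case=> [?|[?|?]] [?|[?|?]]. Qed.

Lemma star_adj_irrefl : irreflexive star_adj.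
Proof. by case=> [?|[?|?]]. Qed.

Definition star : sgraph := SGraph star_adj_sym star_adj_irrefl.

Definition center : star := inl tt.
Definition leaf (i : 'I_b) : star := inr (inl i).
Definition isolated (j : 'I_c) : star := inr (inr j).

Definition leaves : {set star} := leaf @: setT.

(** Keeping [P] general covers both weights and neighborhood sums, where [P] is adjacency to a fixed
    vertex. *)
Lemma sum_star (P : pred star) (F : star -> nat) :
  \sum_(u : star | P u) F u = (if P center then F center else 0) +
    (\sum_(i | P (leaf i)) F (leaf i) + \sum_(j | P (isolated j)) F (isolated j)).
Proof.
rewrite big_sumType big_sumType; congr (_ + _).
by rewrite big_mkcond (big_pred1 tt) //; case.
Qed.

Lemma pid_number_star : 1 < b -> pid_number star = c.+2.
Proof.
move=> b_gt1; apply/eqP; rewrite eqn_leq; apply/andP; split.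
  pose f : {ffun star -> 'I_3} := [ffun v : star =>
    match v with inl _ => inord 2 | inr (inl _) => inord 0
    | inr (inr _) => inord 1 end].
  have pidf : pid_function f.
    (* Only leaves have value 0, and the sole neighbor of a leaf is the center, of value 2. *)
    apply/forallP => -[[]|[i|j]]; rewrite !ffunE !inordK //=.
    by rewrite sum_star /= !ffunE inordK //= !big_pred0.
  apply: leq_trans (pid_number_le pidf) _.
  rewrite /weight sum_star /= ffunE inordK // big1 => [|i _]; last first.
    by rewrite ffunE inordK.
  under eq_bigr do rewrite ffunE inordK //.
  by rewrite sum1_card card_ord.
have [f pidf <-] := pid_number_attained star.
(* Lower bound in two parts: 2 from the center together with the leaves, and [c] from the isolated
   vertices. *)
rewrite /weight sum_star /= addnA -(add2n c); apply: leq_add; last first.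
  rewrite -[leqLHS]card_ord -sum1_card; apply: leq_sum => j _.
  by apply: (@pid_function_isolated star f (isolated j)) => // -[|[]].
case fc: (nat_of_ord (f center)) => [|[|k]] //.
  (* Center of value 0: its condition says that the leaves sum to exactly 2. *)
  have := pid_function_zero pidf fc.
  by rewrite sum_star /= [X in _ + (_ + X)]big_pred0 // addn0 add0n => ->.
(* Center of value 1: a leaf of value 0 would have neighborhood sum 1, so all leaves are positive
   and already contribute at least [b]. *)
rewrite (leq_trans b_gt1) // add1n ltnW // ltnS.
rewrite -[leqLHS]card_ord -sum1_card; apply: leq_sum => i _.
rewrite lt0n; apply/eqP => /(pid_function_zero pidf).
by rewrite sum_star /= fc !big_pred0.
Qed.

Lemma pid_number_leaves : pid_number (induced leaves) = b.
Proof.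
rewrite pid_number_edgeless; last first.
  by move=> [u /= /imsetP[i _ ->]] [v /= /imsetP[j _ ->]].
rewrite card_sig -[RHS]card_ord -cardsT.
rewrite -(card_imset _ (_ : injective leaf)); last by move=> i j [].
by apply: eq_card.
Qed.

End StarPlusIsolated.

Theorem theorem3p1 (a b : nat) (ha : 3 <= a) (hb : 3 <= b) :
  exists (G : sgraph) (S : {set G}),
    pid_number G = a /\ pid_number (induced S) = b.
Proof.
(* The star contributes 2, so [a - 2] isolated vertices bring the total to [a]; the truncated
   subtraction is exact by [ha]. *)
exists (star b (a - 2)), (leaves b (a - 2)); split.
  by rewrite pid_number_star ?(ltnW hb) // -addn2 subnK // ltnW.
exact: pid_number_leaves.
Qed.
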